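(* Let $n\ge1$, $N=\{0,1,\dots,n\}$, and let $f(x)=\sum_{u\in U(G)}b_u\langle t(u),x\rangle^2$, with $b_u>0$ for $u\in U(G)$, be a quadratic form in the closure of the principal domain, where $G$ is a subgraph (with edge set $U(G)$) of the complete graph $K_{n+1}$ on vertex set $N$. Then the parallelotope $P_V(f)$ is affinely equivalent to the zonotope $\sum_{u\in U(G)}b_uz(t(u))$, and this zonotope is the base polyhedron of the submodular cut function $\beta_G=\sum_{u\in U(G)}b_u\delta_u$, i.e. $$\sum_{u\in U(G)}b_uz(t(u))=P(\beta_G)=\Big\{x\in\mathbb{R}^N:\ \sum_{i\in S}x_i\le\beta_G(S)\text{ for all }S\subset N,\ \sum_{i\in N}x_i=0\Big\}.$$
   Context: Let $e_0,\dots,e_n$ be the standard orthonormal basis of $\mathbb{R}^N=\mathbb{R}^{n+1}$. For an edge $u=(i,j)$ of $K_{n+1}$ with $i<j$ put $t(u)=e_i-e_j$, and let $z(t)=\{\lambda t:-1\le\lambda\le1\}$. Sums of segments are Minkowski sums. For an edge $u$ and $S\subseteq N$, $\delta_u(S)=1$ if exactly one end of $u$ lies in $S$, and $\delta_u(S)=0$ otherwise. A cut function is a non-negative combination of the functions $\delta_u$. It is submodular: $\beta(S)+\beta(T)\ge\beta(S\cap T)+\beta(S\cup T)$ for all $S,T\subseteq N$. The closure of the principal domain is the cone of quadratic forms $\sum_{0\le i<j\le n}b_{ij}(x_i-x_j)^2$ with $b_{ij}\ge0$. Every such form is written as in the claim, with $G$ the graph of edges $(i,j)$ such that $b_{ij}>0$.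 These forms are considered on the hyperplane $H=\{x\in\mathbb{R}^N:\sum_{i\in N}x_i=0\}$ with the lattice $L$ equal to the orthogonal projection of $\mathbb{Z}^N$ to $H$. The parallelotope $P_V(f)$ is the Voronoi polytope of $f$, considered up to affine equivalence. Let $D$ be the symmetric matrix with $f(x)=x^TDx$. Then $P_V(f)=\{y\in H:\langle v,y\rangle\le\frac12v^TDv\text{ for all }v\in\mathbb{Z}^N\}$. When $f$ is positive definite on $H$, this is the image under the linear bijection $x\mapsto Dx$ of $H$ of the usual Voronoi polytope $\{x\in H:f(x)\le f(x-v)\text{ for all }v\in L\}$. *)

(* Defs.v *)
(* The real numbers are an arbitrary realType. *)
From mathcomp Require Import all_boot all_order all_algebra.
From mathcomp Require Import ring boolp classical_sets reals.

Set Implicit Arguments.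
Unset Strict Implicit.
Unset Printing Implicit Defensive.

Import Order.TTheory GRing.Theory Num.Theory.
Local Open Scope classical_set_scope.
Local Open Scope ring_scope.

(* The vertex set is 'I_n.+1; an edge is an ordered pair (i, j), and the
   condition i < j is imposed on edge sets by is_edge_set. *)
Notation edge n := ('I_n.+1 * 'I_n.+1)%type.

Definition is_edge_set (n : nat) (U : {set edge n}) : Prop :=
  forall u, u \in U -> (u.1 < u.2)%N.

Section Defs.
Variables (R : realType) (n : nat).
Implicit Types (u : edge n) (x y : 'cV[R]_n.+1) (D : 'M[R]_n.+1).
Implicit Types (U : {set edge n}) (b : edge n -> R).
Implicit Types (f : 'cV[R]_n.+1 -> R) (S T : {set 'I_n.+1}).

Definition dot x y : R := (x^T *m y) 0 0.

Definition basis_vec (i : 'I_n.+1) : 'cV[R]_n.+1 := delta_mx i 0.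

Definition edge_vec u : 'cV[R]_n.+1 := basis_vec u.1 - basis_vec u.2.

Definition graph_form U b x : R := \sum_(u in U) b u * dot (edge_vec u) x ^+ 2.

(* The symmetric matrix D with f x = x^T D x, recovered from the quadratic
   form f by polarization; see form_mxE. *)
Definition form_mx f : 'M[R]_n.+1 :=
  \matrix_(i, j) ((f (basis_vec i + basis_vec j)
                   - f (basis_vec i) - f (basis_vec j)) / 2).

Lemma form_mxE f D :
  D^T = D -> (forall x, f x = (x^T *m D *m x) 0 0) -> form_mx f = D.
Proof.
move=> Dsym fE.
pose B x y := (x^T *m D *m y) 0 0.
have BE i j : B (basis_vec i) (basis_vec j) = D i j.
  by rewrite /B /basis_vec trmx_delta -rowE -colE !mxE.
have BD x y : B (x + y) (x + y) = B x x + B x y + (B y x + B y y).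
  have MD (P Q : 'M[R]_1) : (P + Q) 0 0 = P 0 0 + Q 0 0 by rewrite mxE.
  have tD : (x + y)^T = x^T + y^T by apply/matrixP => k l; rewrite !mxE.
  by rewrite /B tD !(mulmxDl, mulmxDr) !MD; ring.
apply/matrixP => i j; rewrite mxE !fE -!/(B _ _) BD !BE.
have -> : D j i = D i j by rewrite -[in LHS]Dsym mxE.
have -> : D i i + D i j + (D i j + D j j) - D i i - D j j = D i j * 2 by ring.
by rewrite mulfK // pnatr_eq0.
Qed.

Definition hyperplane0 : set 'cV[R]_n.+1 := [set x | \sum_i x i 0 = 0].

(* P_V(f), also meaningful for degenerate f.  With D = form_mx f positive
   definite on hyperplane0, it is the image under x |-> D *m x of the usual cell
   of the x in hyperplane0 with f x <= f (x - v) for all lattice vectors v. *)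
Definition voronoi_polytope f : set 'cV[R]_n.+1 :=
  [set y | hyperplane0 y /\
     forall z : 'cV[int]_n.+1,
       let v : 'cV[R]_n.+1 := map_mx intr z in
       dot v y <= 2^-1 * (v^T *m form_mx f *m v) 0 0].

Definition affinely_equivalent (P Q : set 'cV[R]_n.+1) : Prop :=
  exists (A : 'M[R]_n.+1) (c : 'cV[R]_n.+1),
    A \in unitmx /\ [set A *m x + c | x in P] = Q.

Definition segment (t : 'cV[R]_n.+1) : set 'cV[R]_n.+1 :=
  [set l *: t | l in [set l : R | -1 <= l <= 1]].

Definition dilate (a : R) (A : set 'cV[R]_n.+1) : set 'cV[R]_n.+1 :=
  [set a *: x | x in A].

Definition minkowski_sum (I : finType) (J : {set I})
    (A : I -> set 'cV[R]_n.+1) : set 'cV[R]_n.+1 :=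
  [set x | exists a : I -> 'cV[R]_n.+1,
     (forall i, i \in J -> A i (a i)) /\ x = \sum_(i in J) a i].

Definition zonotope U b : set 'cV[R]_n.+1 :=
  minkowski_sum U (fun u => dilate (b u) (segment (edge_vec u))).

Definition cut_indicator u S : R := ((u.1 \in S) (+) (u.2 \in S))%:R.

Definition cut_function U b S : R := \sum_(u in U) b u * cut_indicator u S.

Definition submodular (beta : {set 'I_n.+1} -> R) : Prop :=
  forall S T, beta (S :&: T) + beta (S :|: T) <= beta S + beta T.

(* The total is 0, the value on the full set of any cut function. *)
Definition base_polyhedron (beta : {set 'I_n.+1} -> R) : set 'cV[R]_n.+1 :=
  [set x | (forall S, \sum_(i in S) x i 0 <= beta S) /\ \sum_i x i 0 = 0].

End Defs.

(* Main.v *)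
Require Import Defs.
From mathcomp Require Import all_boot all_order all_algebra.
From mathcomp Require Import ring lra boolp classical_sets reals.

(** The three polytopes - the doubled Voronoi polytope [2 P_V(f)], the zonotope
    [Z] and the base polyhedron [P(beta_G)] - are shown to coincide through the
    cycle of inclusions [Z <= 2 P_V(f) <= P(beta_G) <= Z], so that the affine
    equivalence is the homothety of ratio 2.

    - [Z <= 2 P_V(f)] ([voronoi_of_zonotope]): on [Z] the linear form of an
      integral vector [z] is at most the sum of the [b_u |z_i - z_j|], and
      [|m| <= m ^ 2] for every integer [m].
    - [2 P_V(f) <= P(beta_G)] ([double_voronoi_in_base]): the inequalities of
      [P(beta_G)] are those of [P_V(f)] for the 0/1 vectors, on which [|m|] and
      [m ^ 2] agree.
    - [P(beta_G) <= Z] ([base_in_zonotope]): the edges are removed one at a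
      time.  By [base_split_edge], if [beta] is submodular then every point of
      [P(beta + c delta_u)] is the sum of a point of [P(beta)] and a point of
      [c z(t(u))].  Finding the multiple of [t(u)] to subtract is a problem in
      one real unknown, whose lower and upper bounds are compatible precisely
      by submodularity of [beta]. *)

Set Implicit Arguments.
Unset Strict Implicit.
Unset Printing Implicit Defensive.

Import Order.TTheory GRing.Theory Num.Theory.
Local Open Scope ring_scope.

Section ZonotopeVoronoi.
Variables (R : realType) (n : nat).
Implicit Types (u : edge n) (x y v : 'cV[R]_n.+1) (U : {set edge n}).
Implicit Types (b : edge n -> R) (S T : {set 'I_n.+1}).

Lemma edge_vecE u k :
  edge_vec R u k 0 = (k == u.1)%:R - (k == u.2)%:R.
Proof. by rewrite /edge_vec /basis_vec !mxE !andbT. Qed.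

Lemma dotE x y : dot x y = \sum_k x k 0 * y k 0.
Proof. by rewrite /dot mxE; apply: eq_bigr => k _; rewrite mxE. Qed.

Lemma sum_delta (P : pred 'I_n.+1) i (F : 'I_n.+1 -> R) :
  \sum_(k | P k) (k == i)%:R * F k = (P i)%:R * F i.
Proof.
rewrite big_mkcond (bigD1 i) //= eqxx big1 => [|k /negPf ->].
  by rewrite addr0; case: (P i); rewrite ?mul1r ?mul0r.
by rewrite mul0r if_same.
Qed.

Lemma dot_edge_vec u x : dot (edge_vec R u) x = x u.1 0 - x u.2 0.
Proof.
rewrite dotE; under eq_bigr => k _ do rewrite edge_vecE mulrBl.
by rewrite sumrB !(sum_delta xpredT) !mul1r.
Qed.

Lemma sum_edge_vec S u :
  \sum_(k in S) edge_vec R u k 0 = (u.1 \in S)%:R - (u.2 \in S)%:R.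
Proof.
under eq_bigr => k _ do
  rewrite edge_vecE -[(k == u.1)%:R]mulr1 -[(k == u.2)%:R]mulr1.
by rewrite sumrB !(sum_delta (fun k => k \in S) _ (fun=> 1)) !mulr1.
Qed.

Lemma sum_edge_vec_all u : \sum_k edge_vec R u k 0 = 0.
Proof.
transitivity (\sum_(k in [set: 'I_n.+1]) edge_vec R u k 0).
  by apply: eq_bigl => k; rewrite inE.
by rewrite sum_edge_vec !inE subrr.
Qed.

Lemma graph_form_mxE U b v :
  (v^T *m form_mx (graph_form U b) *m v) 0 0 = graph_form U b v.
Proof.
pose t u := edge_vec R u.
pose D : 'M[R]_n.+1 := \sum_(u in U) b u *: (t u *m (t u)^T).
have DE x : graph_form U b x = (x^T *m D *m x) 0 0.
  rewrite /D mulmx_sumr mulmx_suml summxE; apply: eq_bigr => u _.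
  rewrite -scalemxAr -scalemxAl mxE !mulmxA -(mulmxA (x^T *m t u)) mxE big_ord1.
  have -> : (x^T *m t u) 0 0 = dot (t u) x.
    rewrite dotE mxE; apply: eq_bigr => k _.
    by rewrite [in LHS]mxE mulrC.
  by rewrite -/(dot (t u) x) expr2.
have Dsym : D^T = D.
  rewrite /D linear_sum; apply: eq_bigr => u _ /=.
  by rewrite linearZ /= trmx_mul trmxK.
by rewrite (form_mxE Dsym DE) DE.
Qed.

(** The only case with a strict inequality is that of the ends of [u] lying one
    in [S \ T] and the other in [T \ S]. *)
Lemma cut_indicator_submodular u : submodular (cut_indicator R u).
Proof.
move=> S T; rewrite /cut_indicator !inE.
by case: (u.1 \in S); case: (u.1 \in T);
   case: (u.2 \in S); case: (u.2 \in T) => /=; lra.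
Qed.

Lemma cut_function_submodular U b :
  (forall u, u \in U -> 0 <= b u) -> submodular (cut_function U b).
Proof.
move=> b0 S T; rewrite /cut_function -!big_split /=.
apply: ler_sum => u uU; rewrite -!mulrDr.
by apply: ler_wpM2l; [exact: b0 | exact: cut_indicator_submodular].
Qed.

Lemma sum_setI_setU S T (F : 'I_n.+1 -> R) :
  \sum_(k in S :&: T) F k + \sum_(k in S :|: T) F k =
  \sum_(k in S) F k + \sum_(k in T) F k.
Proof.
rewrite (big_mkcond (fun k => k \in S :&: T)) (big_mkcond (fun k => k \in S :|: T)).
rewrite (big_mkcond (fun k => k \in S)) (big_mkcond (fun k => k \in T)) -!big_split /=.
apply: eq_bigr => k _; rewrite !inE.
by case: (k \in S); case: (k \in T) => /=; lra.
Qed.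

(** Subtracting [l t(u)] from [x] changes [x(S)] only for the sets [S] that
    separate the ends [i], [j] of [u]: those containing [i] require
    [x(S) - beta(S) <= l], those containing [j] require
    [l <= beta(S) - x(S)].  For [S] of the first kind and [T] of the second,
    [u] is cut by neither [S :&: T] nor [S :|: T], hence
    [x(S) + x(T) = x(S :&: T) + x(S :|: T)
       <= beta(S :&: T) + beta(S :|: T) <= beta(S) + beta(T)],
    while the hypothesis on [x] makes these bounds compatible with
    [-c <= l <= c].  The largest of the lower bounds, [-c] included, is
    therefore an admissible choice. *)
Lemma base_split_edge (beta : {set 'I_n.+1} -> R) u (c : R) x :
  submodular beta -> 0 <= c ->
  base_polyhedron (fun S => beta S + c * cut_indicator R u S) x ->
  exists2 l, -c <= l <= c & base_polyhedron beta (x - l *: edge_vec R u).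
Proof.
move=> sub c0 [xS x0].
pose X S := \sum_(k in S) x k 0.
pose l := \big[Num.max/-c]_(S : {set 'I_n.+1} | (u.1 \in S) && (u.2 \notin S))
            (X S - beta S).
have bound (m : R) : -c <= m ->
    (forall S, u.1 \in S -> u.2 \notin S -> X S - beta S <= m) -> l <= m.
  by move=> cm Sm; apply: bigmax_le => // S /andP[]; exact: Sm.
have xS' S : X S <= beta S + c * ((u.1 \in S) (+) (u.2 \in S))%:R := xS S.
exists l.
  apply/andP; split; first exact: bigmax_ge_id.
  apply: bound => [|S iS jS]; first by lra.
  by have := xS' S; rewrite iS (negPf jS) /=; lra.
split=> [S|].
- have -> : \sum_(k in S) (x - l *: edge_vec R u) k 0 =
            X S - l * ((u.1 \in S)%:R - (u.2 \in S)%:R).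
    rewrite -sum_edge_vec mulr_sumr -sumrB.
    by apply: eq_bigr => k _; rewrite !mxE.
  have := xS' S; case iS: (u.1 \in S); case jS: (u.2 \in S) => /=; try lra.
  + have : X S - beta S <= l.
      by apply: (bigmax_sup S) => //; rewrite iS jS.
    by lra.
  + move=> HS; suff : l <= beta S - X S by lra.
    apply: bound => [|T iT jT]; first by lra.
    have := xS' (T :&: S); have := xS' (T :|: S); have := sub T S.
    have := sum_setI_setU T S (fun k => x k 0).
    rewrite -/(X _) -/(X _) -/(X T) -/(X S) !inE iT jS iS (negPf jT) /=.
    lra.
- have -> : \sum_k (x - l *: edge_vec R u) k 0 =
            \sum_k x k 0 - l * \sum_k edge_vec R u k 0.
    by rewrite mulr_sumr -sumrB; apply: eq_bigr => k _; rewrite !mxE.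
  by rewrite x0 sum_edge_vec_all mulr0 subrr.
Qed.

Lemma base_in_zonotope U b :
  (forall u, u \in U -> 0 < b u) ->
  (base_polyhedron (cut_function U b) `<=` zonotope U b)%classic.
Proof.
have [m Um] := ubnP #|U|; elim: m => // m IHm in U Um *.
move=> b_gt0 x xP; have [U0|[u uU]] := set_0Vmem U.
  (* The values [- x i] are nonnegative and add up to 0. *)
  exists (fun=> 0); split=> [u|]; first by rewrite U0 inE.
  rewrite U0 big_set0; case: xP; rewrite /cut_function U0 => xS x0.
  have Nx_ge0 i : 0 <= - x i 0.
    by have := xS [set i]; rewrite big_set1 big_set0 oppr_ge0.
  have : \sum_i - x i 0 == 0 by rewrite sumrN x0 oppr0.
  rewrite psumr_eq0 // => /allP xi0; apply/colP => i; rewrite mxE.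
  by apply/eqP; have := xi0 i (mem_index_enum i); rewrite oppr_eq0.
have b_gt0' w : w \in U :\ u -> 0 < b w by rewrite inE => /andP[_ /b_gt0].
have [|||l /andP[cl lc] yP] :=
    @base_split_edge (cut_function (U :\ u) b) u (b u) x.
- by apply: cut_function_submodular => w /b_gt0' /ltW.
- exact/ltW/b_gt0.
- case: xP => xS x0; split=> // S; apply: le_trans (xS S) _.
  by rewrite /cut_function (big_setD1 u) //= addrC.
have [|a [aZ aE]] := IHm _ _ b_gt0' _ yP.
  by move: Um; rewrite (cardsD1 u U) uU.
exists (fun w => if w == u then l *: edge_vec R u else a w); split=> [w wU|].
  case: eqP => [->|/eqP wu]; last by apply: aZ; rewrite !inE wu.
  have bu := b_gt0 _ uU.
  exists ((l / b u) *: edge_vec R u).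
    exists (l / b u) => //=.
    by rewrite ler_pdivlMr // ler_pdivrMr // mulN1r mul1r cl lc.
  by rewrite scalerA mulrCA divff ?mulr1 // gt_eqF.
rewrite (big_setD1 u) //= eqxx -[LHS](subrK (l *: edge_vec R u)) aE addrC.
by congr (_ + _); apply: eq_bigr => w; rewrite !inE => /andP[/negPf -> _].
Qed.

(** For [x] the sum of the [b_u l_u t(u)] with [|l_u| <= 1] and [v] integral,
    [dot v x] is the sum of the [b_u l_u (v_i - v_j)], which are termwise at
    most [b_u |v_i - v_j| <= b_u (v_i - v_j) ^ 2], and the sum of the latter is
    the value of the form at [v]. *)
Lemma voronoi_of_zonotope U b x :
  (forall u, u \in U -> 0 <= b u) ->
  zonotope U b x -> voronoi_polytope (graph_form U b) (2^-1 *: x).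
Proof.
move=> b0 [a [aZ ->]].
have dotZ v : dot v (2^-1 *: \sum_(u in U) a u) =
              2^-1 * \sum_(u in U) dot v (a u).
  rewrite /dot -scalemxAr mxE mulmx_sumr summxE //.
have aP u : u \in U -> exists2 l : R,
    -1 <= l <= 1 & a u = (b u * l) *: edge_vec R u.
  by move=> /aZ[_ [l lP <-] <-]; exists l; rewrite ?scalerA.
split.
  rewrite /hyperplane0 /=; under eq_bigr => k _ do rewrite mxE summxE.
  rewrite -mulr_sumr exchange_big big1 ?mulr0 //= => u /aP[l _ ->].
  under eq_bigr => k _ do rewrite mxE.
  by rewrite -mulr_sumr sum_edge_vec_all mulr0.
move=> z /=; set v := map_mx _ _; rewrite graph_form_mxE dotZ.
apply: ler_wpM2l; first by rewrite invr_ge0 ler0n.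
apply: ler_sum => u uU; have [l /andP[l_ge l_le] ->] := aP _ uU.
have -> : dot v ((b u * l) *: edge_vec R u) =
          b u * (l * dot (edge_vec R u) v).
  rewrite !dotE !mulr_sumr; apply: eq_bigr => k _.
  by rewrite [(_ *: edge_vec R u) k 0]mxE; ring.
apply: ler_wpM2l; first exact: b0.
pose m : int := z u.1 0 - z u.2 0.
have -> : dot (edge_vec R u) v = m%:~R by rewrite dot_edge_vec !mxE -intrB.
have m_sq : `|m%:~R : R| <= m%:~R ^+ 2.
  rewrite -intr_norm -rmorphXn ler_int -[leRHS]real_normK ?num_real // expr2.
  have [->|m0] := eqVneq m 0; first by rewrite normr0 mulr0.
  by rewrite ler_peMr // -gtz0_ge1 normr_gt0.
apply: le_trans m_sq; apply: le_trans (ler_norm _) _.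
by rewrite normrM ler_piMl // ler_norml l_ge l_le.
Qed.

(** The inequality of [S] in the base polyhedron is the Voronoi inequality of
    the 0/1 indicator vector of [S]. *)
Lemma double_voronoi_in_base U b y :
  voronoi_polytope (graph_form U b) y ->
  base_polyhedron (cut_function U b) (2 *: y).
Proof.
case=> y0 yV; split=> [S|].
  have /= := yV (\col_k (k \in S)%:R); set v := map_mx _ _.
  rewrite graph_form_mxE; have vE k : v k 0 = (k \in S)%:R.
    by rewrite !mxE; case: (k \in S).
  have -> : dot v y = \sum_(k in S) y k 0.
    rewrite dotE [RHS]big_mkcond; apply: eq_bigr => k _.
    by rewrite vE; case: (k \in S); rewrite ?mul1r ?mul0r.
  have -> : graph_form U b v = cut_function U b S.
    apply: eq_bigr => u _; congr (_ * _).
    rewrite dot_edge_vec !vE /cut_indicator.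
    by case: (u.1 \in S); case: (u.2 \in S) => /=; ring.
  have -> : \sum_(k in S) (2 *: y) k 0 = 2 * \sum_(k in S) y k 0.
    by rewrite mulr_sumr; apply: eq_bigr => k _; rewrite mxE.
  lra.
under eq_bigr => k _ do rewrite mxE.
by rewrite -mulr_sumr y0 mulr0.
Qed.

End ZonotopeVoronoi.

Theorem mainTheorem2 (R : realType) (n : nat) (hn : (1 <= n)%N)
    (U : {set edge n}) (hU : is_edge_set U)
    (b : edge n -> R) (hb : forall u, u \in U -> 0 < b u) :
  affinely_equivalent (voronoi_polytope (graph_form U b)) (zonotope U b) /\
  submodular (cut_function U b) /\
  zonotope U b = base_polyhedron (cut_function U b).
Proof.
have b0 u : u \in U -> 0 <= b u by move=> /hb /ltW.
have two0 : 2 != 0 :> R by rewrite pnatr_eq0.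
split; last split.
- exists 2%:M, 0; split; first by rewrite unitmxE det_scalar unitfE expf_neq0.
  apply/seteqP; split=> [_ [y yV <-]|x xZ].
    rewrite addr0 mul_scalar_mx.
    exact/base_in_zonotope/double_voronoi_in_base.
  exists (2^-1 *: x); first exact: voronoi_of_zonotope.
  by rewrite addr0 mul_scalar_mx scalerA divff // scale1r.
- exact: cut_function_submodular.
- apply/seteqP; split=> [x xZ|]; last exact: base_in_zonotope.
  rewrite -[x]scale1r -(divff two0) -scalerA.
  exact/double_voronoi_in_base/voronoi_of_zonotope.
Qed.
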